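(* Let $g$ be a probability kernel on a countable alphabet $A$ such that $\Delta(g)>0$. Then, for all $f\in\mathcal{L}$ and all $\theta\in\mathbb{R}$, $$\sup_{x\in\mathcal{X}^-}\mathbb{E}_{P^x}\left[e^{\theta(f-\mathbb{E}_{P^x}[f])}\right]\le \exp\left(\frac{\theta^2\,\Delta(g)^{-2}}{8}\,\|\underline{\delta}(f)\|_2^2\right).$$ As a consequence, for all $u>0$, $$\sup_{x\in\mathcal{X}^-}P^x\left(\left|f-\mathbb{E}_{P^x}[f]\right|>u\right)\le 2\exp\left(-\frac{2u^2}{\Delta(g)^{-2}\,\|\underline{\delta}(f)\|_2^2}\right).$$
   Context: $A$ is a countable set with the discrete topology; $\mathbb{N}=\{0,1,2,\dots\}$. For integers $i\le j$, $\omega_i^j=(\omega_i,\dots,\omega_j)$ (the empty string if $i>j$). $\mathcal{X}^-=A^{\{\dots,-2,-1\}}$ is the set of left-infinite sequences (pasts). A probability kernel is a function $g:A\times\mathcal{X}^-\to[0,1]$ with $\sum_{s\in A}g(s|x)=1$ for all $x\in\mathcal{X}^-$; for a left-infinite sequence ending at another index $n-1$, $g(\cdot|\cdot)$ denotes the same function after re-indexing (kernels are shift-invariant). For $x\in\mathcal{X}^-$, $P^x$ is the probability measure on $A^{\mathbb{N}}$ specified by $g$ and started with the fixed past $x$: for all $\omega\in A^{\mathbb{N}}$ and $n\ge0$, $P^x([\omega_0^n])=\prod_{j=0}^n g(\omega_j|x\omega_0^{j-1})$, where $x\omega_0^{j-1}$ is the concatenation and $[\omega_0^n]$ the cylinder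 set. For $j\ge1$, $\mathrm{Osc}_j(g)=\sup\{\frac12\sum_{a\in A}|g(a|z)-g(a|z')|: z,z'\in\mathcal{X}^-,\ z_k=z'_k\ \forall k\neq -j\}$, and $\Delta(g)=1-\sum_{j=1}^\infty \mathrm{Osc}_j(g)$. For $f:A^{n+1}\to\mathbb{R}$ and $0\le j\le n$, $\delta_j(f)=\sup\{|f(\omega_0^{j-1}a\,\omega_{j+1}^n)-f(\omega_0^{j-1}b\,\omega_{j+1}^n)|: a,b\in A,\ \omega\in A^{n+1}\}$. $\mathcal{L}=\bigcup_{n\ge0}\mathcal{L}_n$ with $\mathcal{L}_n=\{f:A^{n+1}\to\mathbb{R}: \delta_j(f)<\infty,\ j=0,\dots,n\}$; such $f$ is viewed as a function of the coordinates $0,\dots,n$. $\|\underline{\delta}(f)\|_2^2=\sum_{j=0}^n\delta_j(f)^2$ for $f\in\mathcal{L}_n$. *)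

(* Defs.v *)
From HB Require Import structures.
From mathcomp Require Import all_boot all_order all_algebra.
From mathcomp Require Import all_classical all_reals all_analysis.

Set Implicit Arguments.
Unset Strict Implicit.
Unset Printing Implicit Defensive.

Import Order.TTheory GRing.Theory Num.Theory.

Local Open Scope classical_set_scope.
Local Open Scope ring_scope.

Section pasts_and_kernels.
Context {A : pointedType} {R : realType}.

(* A past ( ... , x_{-2}, x_{-1}) is read backwards: [x k] is the coordinate
   of index -(k+1). *)
Definition past : Type := nat -> A.

(* The concatenation x w_0^{j-1}, re-indexed so that its last symbol has
   index -1. *)
Definition past_cat (x : past) (w : nat -> A) (j : nat) : past :=
  fun k => if (k < j)%N then w (j - k.+1)%N else x (k - j)%N.

Definition is_probability_kernel (g : A -> past -> R) : Prop :=
  (forall a x, 0 <= g a x <= 1) /\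
  (forall x, (\esum_(a in [set: A]) (g a x)%:E)%E = 1%E).

(* Meaningful for j >= 1: the coordinate of index -j of z is z (j-1). *)
Definition Osc (g : A -> past -> R) (j : nat) : \bar R :=
  ereal_sup [set s | exists z z' : past,
    (forall k, k.+1 <> j -> z k = z' k) /\
    s = ((2^-1)%:E * \esum_(a in [set: A]) `|g a z - g a z'|%:E)%E].

Definition Delta (g : A -> past -> R) : \bar R :=
  (1 - \sum_(1 <= j <oo) Osc g j)%E.

End pasts_and_kernels.

Arguments past : clear implicits.

Section path_measures.
Context {A : pointedType} {R : realType}.

(* The cylinder set [w_0^n]. *)
Definition cylinder (w : nat -> A) (n : nat) : set (nat -> A) :=
  [set v | forall i, (i <= n)%N -> v i = w i].

Definition cylinders : set (set (nat -> A)) :=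
  [set C | exists w n, C = cylinder w n].

(* A^N with the sigma-algebra generated by the cylinders; for countable A it
   is the Borel sigma-algebra of the product of the discrete topologies. *)
Definition paths := g_sigma_algebraType cylinders.

(* P is the measure P^x specified by g and started from the fixed past x;
   this determines P, as the cylinders generate the sigma-algebra. *)
Definition specified_by (g : A -> past A -> R) (x : past A)
    (P : probability paths R) : Prop :=
  forall (w : nat -> A) (n : nat),
    P (cylinder w n) = (\prod_(j < n.+1) g (w j) (past_cat x w j))%:E.

End path_measures.

Arguments paths : clear implicits.

Section local_functions.
Context {A : pointedType} {R : realType} {n : nat}.

Definition replace (w : n.+1.-tuple A) (j : 'I_n.+1) (a : A) : n.+1.-tuple A :=
  [tuple if i == j then a else tnth w i | i < n.+1].

Definition delta (f : n.+1.-tuple A -> R) (j : 'I_n.+1) : \bar R :=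
  ereal_sup [set s | exists (a b : A) (w : n.+1.-tuple A),
    s = `|f (replace w j a) - f (replace w j b)|%:E].

(* f belongs to L_n *)
Definition finite_oscillations (f : n.+1.-tuple A -> R) : Prop :=
  forall j, (delta f j < +oo)%E.

(* [fine] is harmless on finite_oscillations functions. *)
Definition delta_norm_sq (f : n.+1.-tuple A -> R) : R :=
  \sum_(j < n.+1) fine (delta f j) ^+ 2.

(* f viewed as a function of the coordinates 0, ..., n *)
Definition on_paths (f : n.+1.-tuple A -> R) : paths A -> R :=
  fun w => f [tuple w i | i < n.+1].

End local_functions.

(* Main.v *)
(* Let L h (y) be the mean, under the law of the next symbol a given the past y,
   of h at the past y extended by a.  By the Markov property, with f read as a
   function of the last n + 1 symbols of a past, E_{P^x}[f] = L^(n+1) f (x).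
   If D_i is the oscillation of L^i f in the most recent symbol, Hoeffding's
   lemma at each step gives L^m (exp (theta f)) <= exp (theta L^m f +
   theta^2 / 8 * \sum_(i < m) D_i^2).  Changing the symbol of index -j in the
   past moves the law of the next symbol by at most Osc_j(g) in total variation,
   so the oscillation of L h at index -j is at most the one of h at index
   -(j+1) plus Osc_j(g) times the oscillation of h in the most recent symbol.
   Iterating, D_i <= d_i + \sum_(l < i) Osc_(i-l)(g) D_l with
   d_i = delta_(n-i)(f), and since \sum_j Osc_j(g) = 1 - Delta(g) this gives
   |D|_2 <= Delta(g)^(-1) |d|_2. *)

Require Import Defs.
From HB Require Import structures.
From mathcomp Require Import all_boot all_order all_algebra.
From mathcomp Require Import all_classical all_reals all_analysis.
From mathcomp Require Import ring lra.

Set Implicit Arguments.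
Unset Strict Implicit.
Unset Printing Implicit Defensive.

Import Order.TTheory GRing.Theory Num.Theory.
Import numFieldNormedType.Exports.

Local Open Scope classical_set_scope.
Local Open Scope ring_scope.

(** * The moment generating function of a two-point law *)

Section two_point.
Context {R : realType}.

Lemma ge0_is_derive_le (f df : R -> R) (a b : R) : a <= b ->
  (forall x : R, is_derive x 1 f (df x)) -> (forall x, a <= x -> 0 <= df x) ->
  f a <= f b.
Proof.
move=> ab fdf df0; rewrite -subr_ge0.
have cf : {within `[a, b], continuous f}.
  apply: continuous_subspaceT => x.
  exact/differentiable_continuous/derivable1_diffP.
have [c] := MVT_segment ab (fun x _ => fdf x) cf.
rewrite in_itv/= => /andP[ac _] ->; rewrite mulr_ge0 ?subr_ge0//.
exact: df0.
Qed.

(** The log moment generating function [l] has as derivative the tilted probability [q], whose own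
    derivative [q (1 - q)] is at most 1/4. Comparing derivatives twice from 0, where [q 0 = p] and
    [l 0 = 0], gives the bound. *)
Lemma two_point_mgf_ge0 (p u : R) : 0 <= p <= 1 -> 0 <= u ->
  1 - p + p * expR u <= expR (p * u + u ^+ 2 / 8).
Proof.
move=> /andP[p0 p1] u0.
pose z (x : R) := 1 - p + p * expR x.
have z0 (x : R) : 0 < z x.
  rewrite /z; have := expR_gt0 x => ex.
  have [->|pN0] := eqVneq p 0; first by rewrite mul0r; lra.
  have : 0 < p * expR x by rewrite mulr_gt0// lt_neqAle eq_sym pN0.
  lra.
have z' (x : R) : is_derive x 1 z (p * expR x).
  pose D := is_deriveD (is_derive_cst (1 - p) x 1)
    (is_deriveZ p (is_derive_expR x)).
  by apply: is_derive_eq D _; rewrite add0r.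
pose l x := ln (z x).
have l' (x : R) : is_derive x 1 l (p * expR x / z x).
  by rewrite mulrC; exact: is_derive1_comp (is_derive1_ln (z0 x)) (z' x).
(* With the quotient written as an exponential, the logistic equation [q' = q (1 - q)] is a chain
   rule. *)
pose q x := p * expR (x - l x).
have qE x : q x = p * expR x / z x.
  by rewrite /q expRB lnK ?mulrA// posrE.
have q' (x : R) : is_derive x 1 q (q x * (1 - q x)).
  have idl' := is_deriveB (is_derive_id x 1) (l' x).
  pose D := is_deriveZ p (is_derive1_comp (is_derive_expR ((id - l) x)) idl').
  by apply: is_derive_eq D _; rewrite -qE /GRing.scale/= mulrA.
have q0 : q 0 = p by rewrite qE /z expR0 mulr1 subrK divr1.
have qp x : 0 <= x -> q x <= p + 4^-1 * x.
  move=> x0; rewrite -subr_ge0.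
  pose F (x : R) := p + 4^-1 * x - q x.
  have F' (y : R) : is_derive y 1 F (4^-1 - q y * (1 - q y)).
    pose D := is_deriveB (is_deriveD (is_derive_cst p y 1)
      (is_deriveZ 4^-1 (is_derive_id y 1))) (q' y).
    by apply: is_derive_eq D _; rewrite add0r /GRing.scale/= mulr1.
  have := ge0_is_derive_le x0 F'; rewrite {1}/F q0 mulr0 addr0 subrr.
  apply=> y _; have := sqr_ge0 (q y - 2^-1).
  by rewrite (_ : (_ - _) ^+ 2 = 4^-1 - q y * (1 - q y))//; field.
pose G (x : R) := p * x + 8^-1 * x ^+ 2 - l x.
have G' (y : R) : is_derive y 1 G (p + 4^-1 * y - q y).
  pose D := is_deriveB (is_deriveD (is_deriveZ p (is_derive_id y 1))
    (is_deriveZ 8^-1 (is_deriveX 2 (is_derive_id y 1)))) (l' y).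
  apply: is_derive_eq D _; rewrite qE /GRing.scale/= !mulr1.
  by congr (_ + _ - _); field.
have := ge0_is_derive_le u0 G'; rewrite {1}/G mulr0 expr0n mulr0 addr0.
rewrite /l /z expR0 mulr1 subrK ln1 subr0 => /(_ _)/wrap[|].
  by move=> x /qp; rewrite subr_ge0.
by rewrite subr_ge0 [_ / 8]mulrC -ler_expR lnK// posrE; exact: z0.
Qed.

Lemma two_point_mgf (p u : R) : 0 <= p <= 1 ->
  1 - p + p * expR u <= expR (p * u + u ^+ 2 / 8).
Proof.
move=> p01; have [u0|/ltW u0] := leP 0 u; first exact: two_point_mgf_ge0.
(* For negative [u], exchanging the two points gives the parameters [1 - p] and [- u], up to a
   factor [expR u]. *)
have := @two_point_mgf_ge0 (1 - p) (- u).
rewrite oppr_ge0 subr_ge0 lerBlDr lerDl andbC => /(_ p01 u0).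
rewrite -(ler_pM2l (expR_gt0 u)) -expRD sqrrN subKr mulrDr mulrCA -expRD subrr.
by rewrite expR0 mulr1 (_ : u + _ = p * u + u ^+ 2 / 8);
  [lra|ring].
Qed.

End two_point.

(* With [S = \sum D^2], AM-GM on the cross terms [D i * D l] gives
   [S <= \sum D d + (1 - delta) S]. *)
Lemma renewal_sqr_sum {R : realType} (N : nat) (c d D : nat -> R) (delta : R) :
  0 < delta -> (forall k, 0 <= c k) ->
  (forall m, \sum_(1 <= k < m) c k <= 1 - delta) ->
  (forall i, 0 <= D i) ->
  (forall i, D i <= d i + \sum_(l < i) c (i - l)%N * D l) ->
  \sum_(i < N) D i ^+ 2 <= delta ^- 2 * \sum_(i < N) d i ^+ 2.
Proof.
move=> delta0 c0 csum D0 Dd.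
set S := \sum_(i < N) D i ^+ 2; set V := \sum_(i < N) d i ^+ 2.
have S1 : S <= \sum_(i < N) D i * d i +
    \sum_(i < N) \sum_(l < i) c (i - l)%N * ((D i ^+ 2 + D l ^+ 2) / 2).
  rewrite -big_split/=; apply: ler_sum => i _.
  rewrite expr2 (le_trans (ler_wpM2l (D0 i) (Dd i)))// mulrDr lerD2l.
  rewrite mulr_sumr; apply: ler_sum => l _.
  rewrite mulrCA ler_wpM2l//; have := sqr_ge0 (D i - D l); nra.
(* Reversing the sum over [l] turns the weights into [c 1, ..., c i], of total mass at most
   [1 - delta]. *)
have S2 : \sum_(i < N) \sum_(l < i) c (i - l)%N * D i ^+ 2 <= (1 - delta) * S.
  rewrite mulr_sumr; apply: ler_sum => i _.
  rewrite -mulr_suml ler_wpM2r ?sqr_ge0//.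
  apply: le_trans (csum i.+1).
  rewrite big_add1/= big_mkord (reindex_inj rev_ord_inj)/=.
  by apply: ler_sum => l _; rewrite subKn.
have S3 : \sum_(i < N) \sum_(l < i) c (i - l)%N * D l ^+ 2 <= (1 - delta) * S.
  (* The inner range is widened to [l < N] under the condition [l < i], so that the sums can be
     exchanged; for fixed [l] the weights are then [c 1, ..., c (N - l - 1)]. *)
  under eq_bigr => i _ do
    rewrite (big_ord_widen_cond N xpredT (fun l => c (i - l)%N * D l ^+ 2) (ltnW (ltn_ord i))).
  rewrite (exchange_big_dep xpredT)//= mulr_sumr; apply: ler_sum => l _.
  rewrite -mulr_suml ler_wpM2r ?sqr_ge0//.
  apply: le_trans (csum (N - l)%N).
  rewrite -(big_mkord (fun i => l < i)%N (fun i => c (i - l)%N)).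
  rewrite (big_cat_nat (n := l.+1))//= big_nat_cond big1 ?add0r; last first.
    by move=> i /andP[/andP[_ il] li]; rewrite ltnNge -ltnS il in li.
  rewrite -[l.+1]add1n big_addn big_nat_cond [leRHS]big_nat_cond.
  rewrite big_mkcondr/= [leRHS]big_mkcondr/=; apply: ler_sum => k _.
  by rewrite addnK; case: ifPn.
have S4 : delta * S <= \sum_(i < N) D i * d i.
  have : \sum_(i < N) \sum_(l < i) c (i - l)%N * ((D i ^+ 2 + D l ^+ 2) / 2) <=
      (1 - delta) * S.
    under eq_bigr do under eq_bigr do rewrite mulrA mulrDr.
    under eq_bigr do rewrite -mulr_suml big_split/=.
    rewrite -mulr_suml big_split/= ler_pdivrMr// mulr_natr mulr2n.
    exact: lerD.
  lra.
(* AM-GM: [D d <= (delta D^2 + d^2 / delta) / 2] *)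
have S5 : \sum_(i < N) D i * d i <= (delta * S + V / delta) / 2.
  rewrite mulr_sumr mulr_suml -big_split/= mulr_suml; apply: ler_sum => i _.
  rewrite -subr_ge0 (_ : _ - _ = (delta * D i - d i) ^+ 2 / (2 * delta)).
    by rewrite divr_ge0 ?sqr_ge0// mulr_ge0// ltW.
  by field; rewrite lt0r_neq0.
rewrite mulrC ler_pdivlMr ?exprn_gt0//.
have : delta * S <= V / delta by lra.
by rewrite ler_pdivlMr// expr2 mulrA [S * _]mulrC.
Qed.

(** * Integration of functions of a countable-valued variable *)

Section countable_valued.
Context {d} {Omega : measurableType d} {R : realType} {T : choiceType}.
Variables (X : Omega -> T) (cT : countable [set: T]).
Hypothesis mX : forall t, measurable (X @^-1` [set t]).

Lemma measurable_countable_preimage (Y : set T) : measurable (X @^-1` Y).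
Proof.
have [e einj] := elimT (countable_injP _) cT.
have {}einj : injective e by move=> s t; apply: einj; rewrite inE.
rewrite (_ : _ @^-1` _ = \bigcup_(k in e @` Y) (X @^-1` (e @^-1` [set k]))).
  apply: bigcup_measurable => _ [t Yt <-].
  rewrite (_ : e @^-1` _ = [set t])//.
  by apply/seteqP; split=> [s /einj|s /= ->].
apply/seteqP; split=> [w Yw|w [_ [t Yt <-] /= /einj XE]]; last first.
  by rewrite /preimage/= XE.
by exists (e (X w)) => //; exists (X w).
Qed.

Lemma measurable_fun_countable d' (U : measurableType d') (F : T -> U) :
  measurable_fun setT (F \o X).
Proof.
by move=> _ Y mY; rewrite setTI comp_preimage;
  apply: measurable_countable_preimage.
Qed.

(** An injection [e] into the naturals cuts the space into countably many pieces on which [X] is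
    constant; numbers that code no value give empty pieces. *)
Lemma ge0_integral_countable (mu : {measure set Omega -> \bar R})
    (F : T -> \bar R) : (forall t, 0 <= F t)%E ->
  (\int[mu]_w F (X w) = \esum_(t in [set: T]) (F t * mu (X @^-1` [set t])))%E.
Proof.
move=> F0.
have [e einj] := elimT (countable_injP _) cT.
have {}einj : injective e by move=> s t; apply: einj; rewrite inE.
pose B k := X @^-1` (e @^-1` [set k]).
have BT : setT = \bigcup_k B k.
  by apply/seteqP; split=> // w _; exists (e (X w)).
rewrite BT ge0_integral_bigcup//; last 3 first.
- by move=> k; exact: measurable_countable_preimage.
- rewrite -BT => _ Y _; rewrite setTI.
  exact: (measurable_countable_preimage (F @^-1` Y)).
- by apply/trivIsetP => i j _ _; apply: contraNeq => /set0P[w [<- <-]].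
rewrite nneseries_esumT; last by move=> k; exact: integral_ge0.
rewrite (esumID (e @` setT)); last by move=> k _; exact: integral_ge0.
rewrite [X in (_ + X)%E]esum1 ?adde0; last first.
  move=> k [_ Nk]; rewrite (_ : B k = set0) ?integral_set0//.
  by apply/seteqP; split=> // w Bw; apply: Nk; exists (X w).
rewrite setTI esum_image; last by move=> s t _ _; exact: einj.
apply: eq_esum => t _.
have -> : B (e t) = X @^-1` [set t].
  by apply/seteqP; split=> [w /einj|w /= XE]; rewrite ?/B /preimage/= ?XE.
transitivity (\int[mu]_(w in X @^-1` [set t]) cst (F t) w)%E.
  by apply: eq_integral => w; rewrite inE => /= ->.
by rewrite integral_cst.
Qed.

End countable_valued.

Lemma ge0_esumZl {R : realType} {T : choiceType} (S : set T) (a : T -> \bar R)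
    (c : R) : 0 <= c -> (forall t, 0 <= a t)%E ->
  (\esum_(t in S) (c%:E * a t) = c%:E * \esum_(t in S) a t)%E.
Proof.
move=> c0 a0; rewrite /esum -ereal_supZl//; last first.
  by apply/set0P; exists 0%E; exists set0; rewrite ?fsbig_set0//;
    exact: fsets_set0.
congr ereal_sup; rewrite image_comp; apply: eq_imagel => B _ /=.
by rewrite ge0_mule_fsumr.
Qed.

(** * Extended pasts, finite prefixes and measurability *)

Section shifted_pasts.
Context {A : pointedType}.

Definition past_cons (a : A) (y : past A) : past A :=
  fun k => if k is k'.+1 then y k' else a.

Lemma past_cat0 (x : past A) w : past_cat x w 0 = x.
Proof. by apply/funext => k; rewrite /past_cat subn0. Qed.

Lemma past_catS (x : past A) w m :
  past_cat x w m.+1 = past_cons (w m) (past_cat x w m).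
Proof.
by apply/funext => -[|k]; rewrite /past_cat/= ?subn1// ltnS !subSS.
Qed.

Lemma past_cat1 (x : past A) w : past_cat x w 1 = past_cons (w 0%N) x.
Proof. by rewrite past_catS past_cat0. Qed.

Lemma eq_past_cat (x : past A) v w m : (forall i, (i < m)%N -> v i = w i) ->
  past_cat x v m = past_cat x w m.
Proof.
move=> vw; apply/funext => k; rewrite /past_cat; case: ifPn => // km.
by apply: vw; rewrite ltn_subrL (leq_ltn_trans _ km).
Qed.

Definition prefix_tuple m (w : paths A) : m.-tuple A := [tuple w i | i < m].

Lemma nth_prefix_tuple m (w : paths A) i : (i < m)%N ->
  nth point (prefix_tuple m w) i = w i.
Proof. by move=> im; rewrite -(tnth_nth _ _ (Ordinal im)) tnth_mktuple. Qed.

Lemma prefix_tupleP m (w : paths A) (t : m.-tuple A) :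
  prefix_tuple m w = t <-> forall i, (i < m)%N -> w i = nth point t i.
Proof.
split=> [<- i im|wt]; first by rewrite nth_prefix_tuple.
apply/eq_from_tnth => i; rewrite tnth_mktuple (tnth_nth point).
exact: wt.
Qed.

Lemma past_cat_prefix_tuple (x : past A) w m :
  past_cat x (nth point (prefix_tuple m w)) m = past_cat x w m.
Proof. by apply: eq_past_cat => i im; rewrite nth_prefix_tuple. Qed.

Lemma measurable_cylinder (w : nat -> A) n :
  measurable (cylinder w n : set (paths A)).
Proof. by apply: sub_sigma_algebra; exists w, n. Qed.

Lemma prefix_tuple_fiber m (t : m.+1.-tuple A) :
  @prefix_tuple m.+1 @^-1` [set t] = cylinder (nth point t) m.
Proof.
by apply/seteqP; split=> w /=;
  [move/prefix_tupleP|move=> wt; apply/prefix_tupleP].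
Qed.

Lemma measurable_prefix_tuple_fiber m (t : m.-tuple A) :
  measurable (@prefix_tuple m @^-1` [set t]).
Proof.
(* [cylinder w n] fixes [n + 1] coordinates, so the empty prefix is treated apart: its fibre is the
   whole space. *)
case: m t => [t|m t]; last first.
  by rewrite prefix_tuple_fiber; exact: measurable_cylinder.
rewrite (_ : _ @^-1` _ = setT)//; apply/seteqP; split=> // w _ /=.
by apply/prefix_tupleP.
Qed.

Hypothesis countable_A : countable [set: A].

Lemma countable_tuple m : countable [set: m.-tuple A].
Proof.
have [e einj] := elimT (countable_injP _) countable_A.
have {}einj : injective e by move=> s t; apply: einj; rewrite inE.
apply/countable_injP; exists (fun t : m.-tuple A => pickle (map_tuple e t)).
move=> s t _ _ /(pcan_inj pickleK)/(congr1 val)/= /(inj_map einj).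
exact: val_inj.
Qed.

(** The extended past depends on the path only through its first [m] symbols, which take countably
    many values. *)
Lemma measurable_past_cat d (U : measurableType d) (h : past A -> U) x m :
  measurable_fun setT (fun w : paths A => h (past_cat x w m)).
Proof.
rewrite (_ : (fun w => _) =
    (fun t : m.-tuple A => h (past_cat x (nth point t) m)) \o @prefix_tuple m).
  apply: measurable_fun_countable; first exact: countable_tuple.
  exact: measurable_prefix_tuple_fiber.
by apply/funext => w /=; rewrite past_cat_prefix_tuple.
Qed.

End shifted_pasts.

Lemma convex_combination_expR {R : realType} (p u : R) : 0 <= p <= 1 ->
  expR (p * u) <= 1 - p + p * expR u.
Proof.
move=> p01.
have := convex_expR (Itv01 (andP p01).1 (andP p01).2) u 0.
by rewrite !convRE/= /unstable.onem expR0 mulr0 addr0 mulr1 addrC.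
Qed.

(** The infimum is the lower endpoint. This turns a bound on differences into an interval of length
    [D], as Hoeffding's lemma and the coupling of two laws require. *)
Lemma bounded_range {R : realType} {T : pointedType} (phi : T -> R) (D : R) :
  (forall s t, phi s - phi t <= D) -> exists m, forall t, m <= phi t <= m + D.
Proof.
move=> phiD; exists (inf (range phi)) => t.
have lb : has_lbound (range phi).
  by exists (phi point - D) => _ [s _ <-]; rewrite lerBlDr -lerBlDl.
rewrite ge_inf//=; last by exists t.
rewrite -lerBlDr lb_le_inf//; first by exists (phi point), point.
by move=> _ [s _ <-]; rewrite lerBlDr -lerBlDl.
Qed.

(** * The Markov property of the path measures *)

Section kernel.
Context {R : realType} {A : pointedType}.
Variables (countable_A : countable [set: A]) (g : A -> past A -> R).
Hypothesis g_kernel : is_probability_kernel g.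
Variable P : past A -> probability (paths A) R.
Hypothesis P_spec : forall x, specified_by g x (P x).

Let g_ge0 a y : 0 <= g a y. Proof. by have /andP[] := g_kernel.1 a y. Qed.

Lemma prefix_tuple_measure x m (t : m.-tuple A) :
  P x (@prefix_tuple A m @^-1` [set t]) =
  (\prod_(j < m) g (nth point t j) (past_cat x (nth point t) j))%:E.
Proof.
case: m t => [t|m t]; last by rewrite prefix_tuple_fiber P_spec.
rewrite big_ord0 (_ : _ @^-1` _ = setT) ?probability_setT//.
by apply/seteqP; split=> // w _; apply/prefix_tupleP.
Qed.

Lemma prefix_tuple_next_fiber m (t : m.-tuple A) a :
  (fun w : paths A => (prefix_tuple m w, w m)) @^-1` [set (t, a)] =
  cylinder (fun i => if (i < m)%N then nth point t i else a) m.
Proof.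
apply/seteqP; split=> w /=.
  move=> [/prefix_tupleP wt <-] i; rewrite leq_eqVlt => /predU1P[->|im].
    by rewrite ltnn.
  by rewrite im wt.
move=> wta; have := wta m (leqnn m); rewrite ltnn => ->; congr (_, _).
by apply/prefix_tupleP => i im; rewrite (wta i (ltnW im)) im.
Qed.

(** The last factor of the cylinder formula is the conditional law of the next symbol given the
    prefix. *)
Lemma prefix_tuple_next_measure x m (t : m.-tuple A) a :
  P x ((fun w : paths A => (prefix_tuple m w, w m)) @^-1` [set (t, a)]) =
  (P x (@prefix_tuple A m @^-1` [set t]) *
   (g a (past_cat x (nth point t) m))%:E)%E.
Proof.
rewrite prefix_tuple_next_fiber P_spec prefix_tuple_measure -EFinM.
rewrite big_ord_recr/= ltnn; congr (_ * g a _)%:E.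
  apply: eq_bigr => j _; rewrite ltn_ord; congr (g _ _).
  by apply: eq_past_cat => i ij; rewrite (ltn_trans ij).
by apply: eq_past_cat => i ->.
Qed.

Lemma first_step_ge0 (F : A -> \bar R) y : (forall a, 0 <= F a)%E ->
  (\int[P y]_w F (w 0%N) = \esum_(a in [set: A]) (F a * (g a y)%:E))%E.
Proof.
move=> F0.
have fibE a : (fun w : paths A => w 0%N) @^-1` [set a] = cylinder (fun=> a) 0.
  apply/seteqP; split=> [w wa i|w wa]; last exact: wa.
  by rewrite leqn0 => /eqP ->.
rewrite (ge0_integral_countable (X := fun w : paths A => w 0%N))//; last first.
  by move=> a; rewrite fibE; exact: measurable_cylinder.
apply: eq_esum => a _; congr (_ * _)%E.
by rewrite fibE; apply: etrans (P_spec y (fun=> a) 0) _;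
  rewrite big_ord1 past_cat0.
Qed.

(** Both sides become sums over prefixes. On the left the sum over pairs of a prefix and a next
    symbol is iterated, and its inner sum is a first step started from the past extended by the
    prefix. *)
Lemma markov_step_ge0 x m (F : past A -> \bar R) : (forall y, 0 <= F y)%E ->
  (\int[P x]_w F (past_cat x w m.+1) =
   \int[P x]_w \int[P (past_cat x w m)]_v F (past_cat (past_cat x w m) v 1))%E.
Proof.
move=> F0.
pose hist (t : m.-tuple A) := past_cat x (nth point t) m.
pose Phi (ta : m.-tuple A * A) := F (past_cons ta.2 (hist ta.1)).
pose Psi (t : m.-tuple A) := (\int[P (hist t)]_v F (past_cat (hist t) v 1))%E.
pose next (w : paths A) := (prefix_tuple m w, w m).
transitivity (\int[P x]_w Phi (next w))%E.
  apply: eq_integral => w _.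
  by rewrite past_catS /Phi /hist/= past_cat_prefix_tuple.
have cnext : countable [set: m.-tuple A * A].
  by rewrite -setXTT; apply: countableX => //; exact: countable_tuple.
have mnext ta : measurable (next @^-1` [set ta]).
  by case: ta => t a; rewrite prefix_tuple_next_fiber;
    exact: measurable_cylinder.
rewrite (ge0_integral_countable cnext mnext (P x) (F := Phi))//; last first.
  by move=> ta; exact: F0.
transitivity (\int[P x]_w Psi (prefix_tuple m w))%E; last first.
  by apply: eq_integral => w _; rewrite /Psi /hist/= past_cat_prefix_tuple.
rewrite (ge0_integral_countable (countable_tuple countable_A m)
  (@measurable_prefix_tuple_fiber A m) (P x) (F := Psi)); last first.
  by move=> t; apply: integral_ge0.
pose b t a := (Phi (t, a) * P x (next @^-1` [set (t, a)]))%E.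
transitivity (\esum_(ta in [set: m.-tuple A] `*`` (fun=> [set: A])) b ta.1 ta.2)%E.
  rewrite (_ : _ `*`` _ = setT); last by apply/seteqP; split.
  by apply: eq_esum => -[].
rewrite -esum_esum; last by move=> t a _ _; rewrite mule_ge0 ?F0.
apply: eq_esum => t _.
under eq_esum do rewrite /b prefix_tuple_next_measure muleCA prefix_tuple_measure.
rewrite ge0_esumZl; last 2 first.
- by apply: prodr_ge0.
- by move=> a; rewrite mule_ge0 ?lee_fin ?F0.
rewrite muleC; congr (_ * _)%E; last exact/esym/prefix_tuple_measure.
rewrite /Psi; under eq_integral do rewrite past_cat1.
by rewrite (first_step_ge0 (F := fun a => F (past_cons a (hist t)))).
Qed.


(** * Expectations of bounded functions of the past *)

Definition norm_bounded (h : past A -> R) := exists M, forall y, `|h y| <= M.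

Definition expect x m (h : past A -> R) : R := \int[P x]_w h (past_cat x w m).

(** This is the operator [L], expressed through the first symbol of a path under [P y]. *)
Definition step (h : past A -> R) (y : past A) : R := expect y 1 h.

Lemma integrable_past_cat x m h : norm_bounded h ->
  (P x).-integrable setT (EFin \o (fun w => h (past_cat x w m))).
Proof.
move=> [M hM]; apply: measurable_bounded_integrable => //.
- exact: le_lt_trans (probability_le1 (P x) measurableT) (ltry _).
- exact: measurable_past_cat.
- exists M; split; first exact: num_real.
  by move=> K MK w _; exact: le_trans (hM _) (ltW MK).
Qed.

Lemma norm_bounded_cst c : norm_bounded (fun=> c).
Proof. by exists `|c|. Qed.

Lemma norm_boundedD h k :
  norm_bounded h -> norm_bounded k -> norm_bounded (fun y => h y + k y).
Proof.
move=> [M hM] [N kN]; exists (M + N) => y.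
by rewrite (le_trans (ler_normD _ _))// lerD.
Qed.

Lemma norm_boundedZ c h : norm_bounded h -> norm_bounded (fun y => c * h y).
Proof.
by move=> [M hM]; exists (`|c| * M) => y; rewrite normrM ler_wpM2l.
Qed.

Lemma norm_bounded_expR h : norm_bounded h -> norm_bounded (fun y => expR (h y)).
Proof.
move=> [M hM]; exists (expR M) => y; rewrite ger0_norm ?expR_ge0// ler_expR.
exact: le_trans (ler_norm _) (hM y).
Qed.

Lemma expect_cst x m c : expect x m (fun=> c) = c.
Proof.
rewrite /expect Rintegral_cst// -[RHS]mulr1; congr (_ * _).
exact: (congr1 (@fine R) (probability_setT (P x))).
Qed.

Lemma expectD x m h k : norm_bounded h -> norm_bounded k ->
  expect x m (fun y => h y + k y) = expect x m h + expect x m k.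
Proof. by move=> bh bk; apply: RintegralD => //;
  exact: integrable_past_cat. Qed.

Lemma expectZ x m c h : norm_bounded h ->
  expect x m (fun y => c * h y) = c * expect x m h.
Proof. by move=> bh; apply: RintegralZl => //; exact: integrable_past_cat. Qed.

Lemma le_expect x m h k : norm_bounded h -> norm_bounded k ->
  (forall y, h y <= k y) -> expect x m h <= expect x m k.
Proof. by move=> bh bk hk; apply: le_Rintegral => //;
  exact: integrable_past_cat. Qed.

Lemma EFin_expect x m h : norm_bounded h ->
  (expect x m h)%:E = (\int[P x]_w (h (past_cat x w m))%:E)%E.
Proof.
move=> bh; rewrite /expect /Rintegral fineK//.
by apply: integrable_fin_num => //; exact: integrable_past_cat.
Qed.

Lemma norm_bounded_step h : norm_bounded h -> norm_bounded (step h).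
Proof.
move=> bh; have [M hM] := bh; exists M => y; rewrite ler_norml /step.
apply/andP; split.
  rewrite -[leLHS](expect_cst y 1); apply: le_expect => //.
    exact: norm_bounded_cst.
  by move=> z; have := hM z; rewrite ler_norml => /andP[].
rewrite -[leRHS](expect_cst y 1); apply: le_expect => //.
  exact: norm_bounded_cst.
by move=> z; have := hM z; rewrite ler_norml => /andP[].
Qed.

Lemma expectS x m h : norm_bounded h -> expect x m.+1 h = expect x m (step h).
Proof.
move=> bh; have [M hM] := bh.
(* Adding the bound [M] makes the function nonnegative, so that [markov_step_ge0] applies; [M] is
   cancelled at the end. *)
pose k y := h y + M.
have bk : norm_bounded k by apply: norm_boundedD => //; exact: norm_bounded_cst.
have k0 y : 0 <= k y by rewrite -lerBlDr sub0r; have := hM y;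
  rewrite ler_norml => /andP[].
have kS : expect x m.+1 k = expect x m (step k).
  apply/EFin_inj; rewrite !EFin_expect//; last exact: norm_bounded_step.
  rewrite (@markov_step_ge0 x m (fun y => (k y)%:E)); last by move=> y;
    rewrite lee_fin.
  by apply: eq_integral => w _; rewrite /step EFin_expect.
apply: (addIr M); rewrite -{1}(expect_cst x m.+1 M) -[in RHS](expect_cst x m M).
rewrite -!expectD//; do ?exact: norm_bounded_cst; last exact: norm_bounded_step.
rewrite -/k kS; congr expect; apply/funext => y.
by rewrite /step /k expectD ?expect_cst//; exact: norm_bounded_cst.
Qed.

Lemma expect_iter_step x m h : norm_bounded h -> expect x m h = iter m step h x.
Proof.
elim: m h => [|m IH] h bh.
  by rewrite /expect; under eq_Rintegral do rewrite past_cat0;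
    exact: (expect_cst x 0 (h x)).
by rewrite expectS// IH ?iterSr//; exact: norm_bounded_step.
Qed.

(** * Exponential moments and oscillations under one step *)

Definition osc_le (h : past A -> R) j (d : R) := forall y z,
  (forall k, k <> j -> y k = z k) -> h y - h z <= d.

(* Hoeffding's lemma: by convexity of [expR], the worst case is a two-point law
   on the endpoints of the range of [a |-> h (past_cons a y)]. *)
Lemma step_expR_le h theta D y : norm_bounded h -> osc_le h 0 D ->
  step (fun z => expR (theta * h z)) y <=
  expR (theta * step h y + theta ^+ 2 * D ^+ 2 / 8).
Proof.
move=> bh hD.
have [s t|m hm] := @bounded_range R A (fun a => h (past_cons a y)) D.
  by apply: hD => -[].
have hcat w : m <= h (past_cat y w 1) <= m + D by rewrite past_cat1.
have bexp : norm_bounded (fun z => expR (theta * h z)).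
  by apply: norm_bounded_expR; exact: norm_boundedZ.
have [D0|D0|D0] := ltgtP D 0.
- by have /andP[l1 l2] := hm point; have := le_trans l1 l2;
  rewrite lerDl leNgt D0.
(* [p] is the weight of the upper endpoint when [h] is written as a mixture of [m] and [m + D]. *)
- pose p z := D^-1 * (h z - m).
  have bp : norm_bounded p.
    by apply: norm_boundedZ; apply: norm_boundedD => //;
      exact: norm_bounded_cst.
  have p01 w : 0 <= p (past_cat y w 1) <= 1.
    have /andP[l1 l2] := hcat w; rewrite /p mulrC ler_pdivrMr// mul1r.
    by rewrite lerBlDl l2 divr_ge0 ?subr_ge0// ltW.
  have hp z : theta * h z = theta * m + p z * (theta * D).
    by rewrite /p; field; rewrite lt0r_neq0.
  set u := theta * D in hp.
  pose k z := expR (theta * m) * (1 + (expR u - 1) * p z).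
  have bk : norm_bounded k.
    apply: norm_boundedZ; apply: norm_boundedD; first exact: norm_bounded_cst.
    exact: norm_boundedZ.
  have step1 : step (fun z => expR (theta * h z)) y <= step k y.
    (* The chord bound needs [p] in [0, 1], which is known on the extensions of [y]; hence the
       comparison path by path. *)
    apply: le_Rintegral => //.
    - exact: (integrable_past_cat y 1 bexp).
    - exact: (integrable_past_cat y 1 bk).
    move=> w _; rewrite /k hp expRD ler_wpM2l ?expR_ge0//.
    apply: le_trans (convex_combination_expR _ (p01 w)) _.
    by rewrite le_eqVlt; apply/orP; left; apply/eqP; ring.
  have stepk : step k y = expR (theta * m) * (1 + (expR u - 1) * step p y).
    have bc := norm_bounded_cst 1; have bZp := norm_boundedZ (expR u - 1) bp.
    rewrite /step (expectZ _ _ _ (norm_boundedD bc bZp)) (expectD _ _ bc bZp).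
    by rewrite expect_cst (expectZ _ _ _ bp).
  have steph : theta * step h y = theta * m + step p y * u.
    have bc := norm_bounded_cst (theta * m); have bZp := norm_boundedZ u bp.
    rewrite /step -(expectZ _ _ _ bh) [expect y 1 p * u]mulrC -(expectZ _ _ _ bp).
    rewrite -[theta * m](expect_cst y 1) -(expectD _ _ bc bZp).
    by congr expect; apply/funext => z; rewrite hp [u * _]mulrC.
  have stepp01 : 0 <= step p y <= 1.
    apply/andP; split.
      by apply: Rintegral_ge0 => w _; have /andP[] := p01 w.
    rewrite -[leRHS](expect_cst y 1); apply: le_Rintegral => //.
    - exact: (integrable_past_cat y 1 bp).
    - exact: (integrable_past_cat y 1 (norm_bounded_cst 1)).
    - by move=> w _; have /andP[] := p01 w.
  apply: le_trans step1 _; rewrite stepk steph -addrA expRD ler_wpM2l ?expR_ge0//.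
  apply: le_trans (le_trans _ (two_point_mgf u stepp01)) _.
    by rewrite le_eqVlt; apply/orP; left; apply/eqP; ring.
  by rewrite /u exprMn.
- have hE w : h (past_cat y w 1) = m.
    by apply/eqP; rewrite eq_le andbC; move: (hcat w); rewrite D0 addr0.
  rewrite D0 expr0n/= mulr0 mul0r addr0 /step /expect.
  under eq_Rintegral do rewrite hE.
  under [in leRHS]eq_Rintegral do rewrite hE.
  by rewrite -![\int[_]__ _]/(expect y 1 (fun=> _)) !expect_cst.
Qed.

Lemma le_step h k y : norm_bounded h -> norm_bounded k ->
  (forall z, h z <= k z) -> step h y <= step k y.
Proof. exact: le_expect. Qed.

Lemma norm_bounded_iter_step m h : norm_bounded h -> norm_bounded (iter m step h).
Proof. by move=> bh; elim: m => //= m; exact: norm_bounded_step. Qed.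

(** Induction on [m]: monotonicity of [step] carries the induction hypothesis one step further, the
    constant [expR C] comes out, and Hoeffding's lemma for [iter m step h] adds the term [D m]. *)
Lemma iter_step_expR_le h theta (D : nat -> R) m x : norm_bounded h ->
  (forall i, osc_le (iter i step h) 0 (D i)) ->
  iter m step (fun z => expR (theta * h z)) x <=
  expR (theta * iter m step h x + theta ^+ 2 * (\sum_(i < m) D i ^+ 2) / 8).
Proof.
move=> bh hD; elim: m x => [|m IH] x.
  by rewrite big_ord0 mulr0 mul0r addr0.
have bhm := norm_bounded_iter_step m bh.
have bexp : norm_bounded (fun z => expR (theta * h z)).
  by apply: norm_bounded_expR; exact: norm_boundedZ.
set C := theta ^+ 2 * (\sum_(i < m) D i ^+ 2) / 8 in IH.
have bexpm : norm_bounded (fun z => expR (theta * iter m step h z)).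
  by apply: norm_bounded_expR; exact: norm_boundedZ.
have /le_trans-> // : iter m.+1 step (fun z => expR (theta * h z)) x <=
    step (fun z => expR C * expR (theta * iter m step h z)) x.
  apply: le_step; [exact: norm_bounded_iter_step|exact: norm_boundedZ|].
  by move=> z; rewrite -expRD addrC; exact: IH.
have -> : step (fun z => expR C * expR (theta * iter m step h z)) x =
    expR C * step (fun z => expR (theta * iter m step h z)) x.
  exact: expectZ.
apply: le_trans (ler_wpM2l (expR_ge0 _) (step_expR_le theta x bhm (hD m))) _.
rewrite iterS -expRD ler_expR; set s := step _ x.
by rewrite big_ord_recr/= le_eqVlt; apply/orP; left; apply/eqP; rewrite /C;
  field.
Qed.

(** Two laws have the same mass 1, so the positive and negative parts of their difference have equal
    mass, each half of the total. *)
Lemma positive_part_sum_le y z (c : R) :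
  ((2^-1)%:E * (\esum_(a in [set: A]) `|g a y - g a z|%:E) <= c%:E)%E ->
  ((\esum_(a in [set: A]) (Num.max (g a y - g a z) 0)%:E) <= c%:E)%E.
Proof.
set S := esum _ (fun a => (Num.max _ _)%:E); set T := esum _ _.
have p0 a : (0 <= (Num.max (g a y - g a z) 0)%:E)%E.
  by rewrite lee_fin le_max lexx orbT.
(* Pointwise, [2 max(u - v, 0) + v = |u - v| + u]; the two units are the total masses of the laws
   given [z] and [y]. *)
have ST : (S + S + 1 = T + 1)%E.
  rewrite -{1}(g_kernel.2 z) -(g_kernel.2 y) -!esumD//; last 3 first.
  - by move=> a _; rewrite lee_fin.
  - by move=> a _; rewrite adde_ge0.
  - by move=> a _; rewrite lee_fin.
  apply: eq_esum => a _; rewrite -!EFinD; congr EFin.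
  have [gyz|gyz] := leP (g a y - g a z) 0.
    by rewrite ler0_norm//; lra.
  by rewrite gtr0_norm//; lra.
have S0 : (0 <= S)%E by apply: esum_ge0.
have -> : T = (S + S)%E.
  by rewrite -[LHS](@addeK _ 1%E)// -ST addeK.
case: S S0 {ST} => [r| |]//= r0.
  by rewrite -EFinD -EFinM !lee_fin; lra.
by rewrite addye// mulry gtr0_sg ?invr_gt0// mul1e.
Qed.

(* Moving the past from [y] to [z] changes [h] along the extension, which costs
   [d], and the law of the next symbol, which costs [c * D] because only the
   deviation of [h] from its minimum over the next symbol matters. *)
Lemma osc_le_step h j d D c : norm_bounded h ->
  osc_le h j.+1 d -> osc_le h 0 D -> (Osc g j.+1 <= c%:E)%E ->
  osc_le (step h) j (d + c * D).
Proof.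
move=> bh hd hD gc y z yz.
have [s t|m hm] := @bounded_range R A (fun a => h (past_cons a z)) D.
  by apply: hD => -[].
have D0 : 0 <= D.
  by have /andP[l1 l2] := hm point; have := le_trans l1 l2; rewrite lerDl.
pose psi a := h (past_cons a z) - m.
have psi01 a : 0 <= psi a <= D.
  by rewrite subr_ge0 lerBlDl.
(* [k] reads only the newest symbol, the older ones being frozen at [z], so [step k y] and
   [step k z] differ only through the law of that symbol. *)
pose k (u : past A) := psi (u 0%N).
have bk : norm_bounded k.
  by exists D => u; rewrite ger0_norm; have /andP[] := psi01 (u 0%N).
have kE u x : k (past_cat x u 1) = psi (u 0%N) by rewrite past_cat1.
have stepk x : (step k x)%:E = (\esum_(a in [set: A]) ((psi a)%:E * (g a x)%:E))%E.
  rewrite /step EFin_expect//; under eq_integral do rewrite kE.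
  rewrite (@first_step_ge0 (fun a => (psi a)%:E))//.
  by move=> a; rewrite lee_fin; have /andP[] := psi01 a.
have kyz : step k y <= step k z + c * D.
  rewrite -lee_fin EFinD !stepk.
  apply: (@le_trans _ _ (\esum_(a in [set: A]) ((psi a)%:E * (g a z)%:E +
      D%:E * (Num.max (g a y - g a z) 0)%:E))%E).
    apply: le_esum => a _; rewrite -!EFinM -EFinD lee_fin.
    have /andP[p0 pD] := psi01 a.
    have : psi a * (g a y - g a z) <= D * Num.max (g a y - g a z) 0.
      apply: le_trans (ler_wpM2l p0 _) (ler_wpM2r _ pD);
        rewrite le_max lexx ?orbT//.
    lra.
  rewrite esumD; last 2 first.
  - by move=> a _; rewrite -EFinM lee_fin mulr_ge0//; have /andP[] := psi01 a.
  - by move=> a _; rewrite -EFinM lee_fin mulr_ge0// le_max lexx orbT.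
  rewrite leeD2l// ge0_esumZl//; last by move=> a;
    rewrite lee_fin le_max lexx orbT.
  rewrite mulrC EFinM lee_wpmul2l ?lee_fin//; apply: positive_part_sum_le.
  (* Position [j] of a past is index -(j+1), so [y] and [z] compete in the supremum [Osc g j.+1]. *)
  apply: le_trans gc; apply: ereal_sup_ubound; exists y, z; split=> // i ij.
  by apply: yz => ijE; apply: ij; rewrite ijE.
have bc e := norm_bounded_cst e.
have -> : step h z = step k z + m.
  rewrite /step -(expect_cst z 1 m) -(expectD _ _ bk (bc m)).
  apply: eq_Rintegral => w _.
  by rewrite kE past_cat1 /psi subrK.
(* Prepending a symbol moves the discrepancy between [y] and [z] from position [j] to [j.+1], where
   it costs [d]. *)
have : step h y <= step k y + (m + d).
  rewrite /step -(expect_cst y 1 (m + d)) -(expectD _ _ bk (bc _)).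
  apply: le_Rintegral => //.
  - exact: (integrable_past_cat y 1 bh).
  - exact: (integrable_past_cat y 1 (norm_boundedD bk (bc (m + d)))).
  move=> w _; rewrite kE past_cat1 /psi addrA subrK -lerBlDl.
  by apply: hd => -[|i] // ij; apply: yz => ijE; apply: ij; rewrite ijE.
lra.
Qed.

(** * Iterated oscillations, exponential moments and tail probabilities *)

Lemma probability_expect x m (Q : pred (past A)) :
  P x [set w | Q (past_cat x w m)] = (expect x m (fun y => (Q y)%:R))%:E.
Proof.
rewrite EFin_expect; last by exists 1 => y; case: (Q y);
  rewrite ?normr0 ?normr1.
have mQ : measurable [set w : paths A | Q (past_cat x w m)].
  have := @measurable_past_cat A countable_A _ bool Q x m measurableT [set true] I.
  by rewrite setTI.
have := integral_indic (P x) measurableT mQ; rewrite setIT => <-.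
apply: eq_integral => w _; rewrite indicE; congr (_%:R%:E).
by rewrite mem_setE.
Qed.

(* [osc_bound c d i j] bounds the oscillation of [iter i step h] in its [j]-th
   coordinate when [d] does so for [h] and [c] bounds the oscillations of [g]. *)
Fixpoint osc_bound (c d : nat -> R) i j : R :=
  if i is i'.+1 then osc_bound c d i' j.+1 + c j.+1 * osc_bound c d i' 0
  else d j.

(** Unrolling the recursion keeps [i + j] constant in the first term; at [j = 0] this is the renewal
    relation assumed by [renewal_sqr_sum]. *)
Lemma osc_bound_renewal c d i j : osc_bound c d i j =
  d (i + j)%N + \sum_(l < i) c (i + j - l)%N * osc_bound c d l 0.
Proof.
elim: i j => [|i IH] j; first by rewrite big_ord0 addr0.
by rewrite big_ord_recr/= IH addSnnS addKn addrA.
Qed.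

Lemma osc_le_iter_step h c d i j : norm_bounded h ->
  (forall k, osc_le h k (d k)) -> (forall k, (Osc g k.+1 <= (c k.+1)%:E)%E) ->
  osc_le (iter i step h) j (osc_bound c d i j).
Proof.
move=> bh hd gc; elim: i j => [|i IH] j /=; first exact: hd.
exact: osc_le_step (norm_bounded_iter_step i bh) (IH _) (IH _) (gc _).
Qed.

Lemma osc_le_ge0 (h : past A -> R) j d : osc_le h j d -> 0 <= d.
Proof. by move=> /(_ (fun=> point) (fun=> point)); rewrite subrr; apply. Qed.

Lemma expect_expR_le h c d (delta theta : R) m x : norm_bounded h ->
  (forall k, osc_le h k (d k)) -> (forall k, (Osc g k.+1 <= (c k.+1)%:E)%E) ->
  0 < delta -> (forall k, 0 <= c k) ->
  (forall k, \sum_(1 <= l < k) c l <= 1 - delta) ->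
  expect x m (fun y => expR (theta * (h y - expect x m h))) <=
  expR (theta ^+ 2 * (delta ^- 2 * \sum_(i < m) d i ^+ 2) / 8).
Proof.
move=> bh hd gc delta0 c0 csum.
have bexp : norm_bounded (fun y => expR (theta * h y)).
  by apply: norm_bounded_expR; exact: norm_boundedZ.
have -> : (fun y => expR (theta * (h y - expect x m h))) =
    (fun y => expR (- (theta * expect x m h)) * expR (theta * h y)).
  by apply/funext => y; rewrite -expRD mulrBr addrC.
rewrite expectZ// !expect_iter_step//.
pose D i := osc_bound c d i 0.
have oscD i : osc_le (iter i step h) 0 (D i) by exact: osc_le_iter_step.
apply: le_trans (ler_wpM2l (expR_ge0 _) (iter_step_expR_le theta m x bh oscD)) _.
(* The centering factor cancels the mean [iter m step h x] in the exponent. *)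
rewrite -expRD addKr ler_expR ler_wpM2r ?invr_ge0// ler_wpM2l ?sqr_ge0//.
apply: (renewal_sqr_sum m delta0 c0 csum) => i;
  first exact: osc_le_ge0 (oscD i).
by rewrite /D osc_bound_renewal addn0.
Qed.

(** Two-sided Chernoff bound: the indicator of the deviation is at most [expR (- (theta * u))] times
    the sum of the exponentials with parameters [theta] and [- theta]. *)
Lemma probability_deviation_le h m x (V u : R) : norm_bounded h -> 0 < V -> 0 < u ->
  (forall theta, expect x m (fun y => expR (theta * (h y - expect x m h))) <=
    expR (theta ^+ 2 * V / 8)) ->
  (P x [set w | (u < `|h (past_cat x w m) - expect x m h|)%R] <=
    (2 * expR (- (2 * u ^+ 2 / V)))%:E)%E.
Proof.
move=> bh V0 u0 mgf; set mu := expect x m h.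
rewrite (probability_expect x m (fun y => u < `|h y - mu|)) lee_fin.
(* This is the minimizer of [- (theta * u) + theta ^+ 2 * V / 8], with minimum
   [- (2 * u ^+ 2 / V)]. *)
pose theta := 4 * u / V.
have theta0 : 0 < theta by rewrite divr_gt0// mulr_gt0.
have bexp t : norm_bounded (fun y => expR (t * (h y - mu))).
  apply: norm_bounded_expR; apply: norm_boundedZ; apply: norm_boundedD => //.
  exact: norm_bounded_cst.
have bsum := norm_boundedD (bexp theta) (bexp (- theta)).
have : expect x m (fun y => (u < `|h y - mu|)%R%:R) <= expect x m (fun y =>
    expR (- (theta * u)) *
      (expR (theta * (h y - mu)) + expR (- theta * (h y - mu)))).
  apply: le_expect; last 2 first.
  - exact: norm_boundedZ.
  - move=> y; have [uy|_] := ltP u `|h y - mu|; last first.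
      by rewrite mulr_ge0 ?addr_ge0 ?expR_ge0.
    rewrite mulrDr -!expRD.
    have [hy|hy] := leP 0 (h y - mu).
      rewrite ger0_norm// in uy.
      apply: ler_wpDr; first exact: expR_ge0.
      rewrite -expR0 ler_expR addrC -mulrBr.
      by apply: mulr_ge0; rewrite ?subr_ge0 ltW.
    rewrite ltr0_norm// in uy.
    apply: ler_wpDl; first exact: expR_ge0.
    rewrite -expR0 ler_expR mulNr -[- (theta * (_ - _))]mulrN addrC -mulrBr.
    by apply: mulr_ge0; rewrite ?subr_ge0 ltW.
  by exists 1 => y; case: (_ < _); rewrite ?normr0 ?normr1.
move=> /le_trans; apply; rewrite expectZ// expectD//.
have -> : - (2 * u ^+ 2 / V) = - (theta * u) + theta ^+ 2 * V / 8.
  by rewrite /theta; field; rewrite lt0r_neq0.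
rewrite expRD mulrCA ler_wpM2l ?expR_ge0// mulr_natl mulr2n lerD//.
by have := mgf (- theta); rewrite sqrrN.
Qed.

End kernel.

(** * Local functions read on the most recent symbols *)

Section local_function.
Context {R : realType} {A : pointedType} {n : nat}.
Variable f : n.+1.-tuple A -> R.
Hypothesis f_osc : finite_oscillations f.

(** Pasts are read backwards: after [n + 1] steps the symbol of time [i] sits at position
    [n - i]. *)
Definition past_fun (y : past A) : R := f [tuple y (n - i)%N | i < n.+1].

Lemma on_paths_past_fun x w : on_paths f w = past_fun (past_cat x w n.+1).
Proof.
congr f; apply/eq_from_tnth => i; rewrite !tnth_mktuple /past_cat ltnS leq_subr.
by congr (w _); rewrite subSS subKn// -ltnS.
Qed.

Definition past_delta j : R :=
  if (j <= n)%N then fine (delta f (inord (n - j))) else 0.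

Lemma sum_past_delta : \sum_(j < n.+1) past_delta j ^+ 2 = delta_norm_sq f.
Proof.
rewrite /delta_norm_sq (reindex_inj rev_ord_inj)/=; apply: eq_bigr => j _.
rewrite /past_delta subSS leq_subr subKn -1?ltnS//.
by rewrite inord_val.
Qed.

Lemma delta_ge0 j : (0 <= delta f j)%E.
Proof.
apply: ereal_sup_ubound; exists point, point, [tuple point | i < n.+1].
by rewrite subrr normr0.
Qed.

Lemma osc_le_past_fun j : osc_le past_fun j (past_delta j).
Proof.
move=> y z yz; rewrite /past_delta; case: ifPn => [jn|jn]; last first.
  rewrite /past_fun (_ : [tuple _ | _ < _] = [tuple z (n - i)%N | i < n.+1]).
    by rewrite subrr.
  apply/eq_from_tnth => i; rewrite !tnth_mktuple; apply: yz => ij.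
  by move: jn; rewrite -ij leq_subr.
set i := inord (n - j); have iE : i = (n - j)%N :> nat by rewrite inordK// ltnS leq_subr.
pose t := [tuple y (n - k)%N | k < n.+1].
have -> : past_fun y = f (replace t i (y j)).
  congr f; apply/eq_from_tnth => k; rewrite !tnth_mktuple.
  by case: eqP => // ->; rewrite iE subKn.
have -> : past_fun z = f (replace t i (z j)).
  congr f; apply/eq_from_tnth => k; rewrite !tnth_mktuple.
  case: eqP => [->|ki]; first by rewrite iE subKn.
  apply/esym/yz => kj; apply: ki; apply: val_inj.
  by rewrite /= iE -kj subKn// -ltnS.
apply: le_trans (ler_norm _) _.
rewrite -lee_fin fineK ?ge0_fin_numE ?delta_ge0//.
by apply: ereal_sup_ubound; exists (y j), (z j), t.
Qed.

(** Telescoping: [mix k] takes its [k] newest symbols from [y] and the others from [z], so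
    consecutive ones differ at a single position. *)
Lemma past_fun_osc y z : past_fun y - past_fun z <= \sum_(j < n.+1) past_delta j.
Proof.
pose mix k i := if (i < k)%N then y i else z i.
have mixP k : past_fun (mix k) - past_fun z <= \sum_(j < k) past_delta j.
  elim: k => [|k IH]; first by rewrite big_ord0 subrr.
  rewrite big_ord_recr/= addrC -(subrKA (past_fun (mix k))) lerD//.
  apply: osc_le_past_fun => i ik; rewrite /mix ltnS leq_eqVlt.
  by case: eqP.
suff <- : past_fun (mix n.+1) = past_fun y by exact: mixP.
congr f; apply/eq_from_tnth => i; rewrite !tnth_mktuple /mix ltnS leq_subr//.
Qed.

Lemma bounded_past_fun : norm_bounded past_fun.
Proof.
exists (`|past_fun (fun=> point)| + \sum_(j < n.+1) past_delta j) => y.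
have := past_fun_osc y (fun=> point); have := past_fun_osc (fun=> point) y.
set a := past_fun y; set b := past_fun _; set D := \sum_(j < _) _ => ba ab.
rewrite ler_norml; have := ler_norm b; have := ler_norm (- b); rewrite normrN.
by move=> ? ?; apply/andP; split; lra.
Qed.

(** This settles the degenerate case of the tail bound, where the quotient in the exponent is
    infinite. *)
Lemma past_fun_cst y z : delta_norm_sq f = 0 -> past_fun y = past_fun z.
Proof.
rewrite -sum_past_delta => /eqP; rewrite psumr_eq0; last by move=> i _;
  exact: sqr_ge0.
move=> /allP d0.
have D0 : \sum_(j < n.+1) past_delta j = 0.
  apply: big1 => j _; apply/eqP; rewrite -sqrf_eq0.
  by apply: (implyP (d0 j _)) => //; rewrite mem_index_enum.
have le_past_fun a b : past_fun a <= past_fun b.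
  by rewrite -subr_le0; apply: le_trans (past_fun_osc a b) _; rewrite D0.
by apply/eqP; rewrite eq_le !le_past_fun.
Qed.

End local_function.

(** * Summability of the oscillations of the kernel *)

Section kernel_oscillations.
Context {R : realType} {A : pointedType}.
Variable g : A -> past A -> R.
Hypothesis Delta_gt0 : (0 < Delta g)%E.

Lemma Osc_ge0 j : (0 <= Osc g j)%E.
Proof.
apply: ereal_sup_ubound; exists (fun=> point), (fun=> point); split=> //.
rewrite esum1 ?mule0// => a _.
by rewrite subrr normr0.
Qed.

Let S := (\sum_(1 <= j <oo) Osc g j)%E.

Let S_ge0 : (0 <= S)%E.
Proof. by apply: nneseries_ge0 => j _ _; exact: Osc_ge0. Qed.

Let S_lt1 : (S < 1)%E.
Proof. by move: Delta_gt0; rewrite /Delta sube_gt0. Qed.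

Let S_fin : S \is a fin_num.
Proof. by rewrite ge0_fin_numE// (lt_trans S_lt1)// ltry. Qed.

(** Positivity of [Delta g] forces the nonnegative series [S] below 1, hence finite, so [fine] loses
    nothing. *)
Lemma fine_Delta_gt0 : 0 < fine (Delta g).
Proof. by rewrite -lte_fin fineK// /Delta fin_numB S_fin. Qed.

Let sum_Osc_le m : (\sum_(1 <= k < m) Osc g k <= S)%E.
Proof. by apply: nneseries_lim_ge => k _ _; exact: Osc_ge0. Qed.

Lemma Osc_fin_num k : Osc g k.+1 \is a fin_num.
Proof.
rewrite ge0_fin_numE ?Osc_ge0// (le_lt_trans _ (lt_trans S_lt1 (ltry _)))//.
apply: le_trans (sum_Osc_le k.+2); rewrite big_nat_recr//= leeDr//.
by apply: sume_ge0 => i _; exact: Osc_ge0.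
Qed.

Lemma sum_fine_Osc_le m :
  \sum_(1 <= k < m) fine (Osc g k) <= 1 - fine (Delta g).
Proof.
rewrite /Delta fineB// subKr -lee_fin fineK// -sumEFin.
rewrite (eq_big_nat _ _ (F2 := Osc g)) ?sum_Osc_le// => -[//|k] _.
by rewrite fineK// Osc_fin_num.
Qed.

End kernel_oscillations.
(* In the second bound the quotient is taken in the extended reals, so that it
   is +oo, and the bound is 0, when f is constant. *)
Theorem theorem3p1 (R : realType) (A : pointedType)
    (countable_A : countable [set: A])
    (g : A -> past A -> R) (g_kernel : is_probability_kernel g)
    (P : past A -> probability (paths A) R)
    (P_spec : forall x, specified_by g x (P x))
    (Delta_gt0 : (0 < Delta g)%E)
    (n : nat) (f : n.+1.-tuple A -> R) (f_osc : finite_oscillations f) :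
  let mean x := fine ('E_(P x)[on_paths f])%E in
  (forall theta : R,
    (ereal_sup [set ('E_(P x)[fun w => expR (theta * (on_paths f w - mean x))])%E
               | x in [set: past A]]
     <= (expR (theta ^+ 2 * fine (Delta g) ^- 2 / 8 * delta_norm_sq f))%:E)%E) /\
  (forall u : R, 0 < u ->
    (ereal_sup [set P x [set w | (u < `|on_paths f w - mean x|)%R]
               | x in [set: past A]]
     <= 2%:E * expeR (- ((2 * u ^+ 2)%:E /
                         (fine (Delta g) ^- 2 * delta_norm_sq f)%:E)))%E).
Proof.
move=> mean.
pose h := past_fun f; have bh : norm_bounded h by exact: bounded_past_fun.
set delta := fine (Delta g); set V := delta ^- 2 * delta_norm_sq f.
have delta0 : 0 < delta by exact: fine_Delta_gt0.
have meanE x : mean x = expect P x n.+1 h.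
  rewrite /mean unlock /expect /Rintegral; congr fine.
  by apply: eq_integral => w _; rewrite (on_paths_past_fun f x).
have mgf theta x :
    expect P x n.+1 (fun y => expR (theta * (h y - expect P x n.+1 h))) <=
    expR (theta ^+ 2 * V / 8).
  rewrite /V -sum_past_delta.
  (* The weights [c] are the oscillations of [g], whose partial sums are at most [1 - delta] by
     definition of [Delta]. *)
  apply: (expect_expR_le countable_A g_kernel P_spec (c := fun k => fine (Osc g k))) => //.
  - exact: osc_le_past_fun.
  - by move=> k; rewrite fineK ?Osc_fin_num.
  - by move=> k; rewrite fine_ge0// Osc_ge0.
  - by move=> k; exact: sum_fine_Osc_le.
split=> [theta|u u0].
  apply: ge_ereal_sup => _ [x _ <-].
  rewrite unlock meanE (_ : theta ^+ 2 * _ / 8 * _ = theta ^+ 2 * V / 8); last first.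
    by rewrite /V; ring.
  apply: le_trans (_ : (_ <= (expect P x n.+1 (fun y =>
      expR (theta * (h y - expect P x n.+1 h))))%:E)%E) _; last by rewrite lee_fin.
  rewrite EFin_expect//; last first.
    apply: norm_bounded_expR; apply: norm_boundedZ; apply: norm_boundedD => //.
    exact: norm_bounded_cst.
  rewrite le_eqVlt; apply/orP; left; apply/eqP; apply: eq_integral => w _.
  by rewrite (on_paths_past_fun f x).
apply: ge_ereal_sup => _ [x _ <-]; rewrite -/V meanE.
have -> : [set w | (u < `|on_paths f w - expect P x n.+1 h|)%R] =
    [set w | (u < `|h (past_cat x w n.+1) - expect P x n.+1 h|)%R].
  by apply/seteqP; split=> w /=; rewrite (on_paths_past_fun f x).
(* As [delta] is positive, [V = 0] makes every oscillation of [f] vanish; then [f] equals its mean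
   and the event is empty. *)
have [V0|V0] := eqVneq V 0.
  have norm0 : delta_norm_sq f = 0.
    by apply/eqP; move/eqP: V0; rewrite mulf_eq0 invr_eq0 expf_eq0/= gt_eqF.
  have hE y : h y = h x by exact: past_fun_cst.
  have -> : [set w | (u < `|h (past_cat x w n.+1) - expect P x n.+1 h|)%R] = set0.
    apply/seteqP; split=> // w /=.
    rewrite (_ : h = fun=> h x); last by apply/funext.
    by rewrite expect_cst subrr normr0 ltNge (ltW u0).
  by rewrite measure0 mule_ge0 ?lee_fin// expeR_ge0.
have {}V0 : 0 < V.
  rewrite lt_neqAle eq_sym V0 mulr_ge0 ?invr_ge0 ?sqr_ge0//.
  by apply: sumr_ge0 => i _; exact: sqr_ge0.
rewrite inver gt_eqF// -EFinM.
by apply: (probability_deviation_le countable_A bh V0 u0) => theta; exact: mgf.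
Qed.
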